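(* Let $d\ge 1$, $p\in[1,+\infty)$, let $|\cdot|$ be a norm on $\mathbb{R}^d$, and let $N$ be an integer with $N\ge c(d,|\cdot|)+1$, or with $N\ge d+2$ if $|\cdot|$ is Euclidean. Let $\mu,\nu\in\mathcal{P}_p(\mathbb{R}^d)$. If there exists a real constant $C$ such that $e_{N,p}^p(\mu,x)=e_{N,p}^p(\nu,x)+C$ for every $x\in(\mathbb{R}^d)^N$, then $\mu=\nu$ (and consequently $C=0$).
   Context: $\mathcal{P}_p(\mathbb{R}^d)$ is the set of Borel probability measures $\mu$ on $\mathbb{R}^d$ with $\int|\xi|^p\mu(d\xi)<+\infty$. For $\mu\in\mathcal{P}_p(\mathbb{R}^d)$ and $N\ge1$, the $L^p$-mean quantization error function at level $N$ is $e_{N,p}(\mu,\cdot):(\mathbb{R}^d)^N\to\mathbb{R}_+$, $e_{N,p}(\mu,(x_1,\dots,x_N))=\big[\int_{\mathbb{R}^d}\min_{1\le i\le N}|\xi-x_i|^p\,\mu(d\xi)\big]^{1/p}$, and $e_{N,p}^p$ denotes its $p$-th power. The points $x_i$ need not be distinct. Let $S_{|\cdot|}(0,1)$ be the unit sphere and $\bar B_{|\cdot|}(a,1)$ the closed unit ball centered at $a$ for the norm $|\cdot|$. The minimal sphere covering number is $c(d,|\cdot|)=\min\{k:\exists\,\{a_1,\dots,a_k\}\subset S_{|\cdot|}(0,1)\text{ with }S_{|\cdot|}(0,1)\subset\bigcup_{i=1}^k\bar B_{|\cdot|}(a_i,1)\}$, which is finite. ''Euclidean'' means that the norm is induced by an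 inner product. *)

(* Defs.v *)
From HB Require Import structures.
From mathcomp Require Import all_boot all_order all_algebra sesquilinear.
From mathcomp Require Import all_classical all_reals all_analysis.

Set Implicit Arguments.
Unset Strict Implicit.
Unset Printing Implicit Defensive.

Import Order.TTheory GRing.Theory Num.Theory.
Import numFieldNormedType.Exports.

Local Open Scope classical_set_scope.
Local Open Scope ring_scope.

(* The canonical norm of 'rV[R]_d is the sup norm. It only provides the
   topology, hence the Borel sets; the norm of the problem is an arbitrary
   function nrm : 'rV[R]_d -> R satisfying is_norm. *)
Definition borel_rV (R : realType) (d : nat) :=
  g_sigma_algebraType (@open 'rV[R]_d).

Definition is_norm (R : realType) (d : nat) (nrm : 'rV[R]_d -> R) : Prop :=
  [/\ forall x y, nrm (x + y) <= nrm x + nrm y,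
      forall (a : R) x, nrm (a *: x) = `|a| * nrm x
    & forall x, nrm x = 0 -> x = 0].

Definition euclidean_norm (R : realType) (d : nat) (nrm : 'rV[R]_d -> R) :
    Prop :=
  exists phi : {dot 'rV[R]_d for idfun},
    forall x, nrm x = Num.sqrt (phi x x).

Definition unit_sphere (R : realType) (d : nat) (nrm : 'rV[R]_d -> R) :
    set 'rV[R]_d :=
  [set x | nrm x = 1].

Definition closed_unit_ball (R : realType) (d : nat) (nrm : 'rV[R]_d -> R)
    (a : 'rV[R]_d) : set 'rV[R]_d :=
  [set x | nrm (x - a) <= 1].

Definition sphere_cover (R : realType) (d : nat) (nrm : 'rV[R]_d -> R)
    (k : nat) : Prop :=
  exists a : 'I_k -> 'rV[R]_d,
    (forall i, unit_sphere nrm (a i)) /\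
    unit_sphere nrm `<=` \bigcup_i closed_unit_ball nrm (a i).

Definition is_sphere_covering_number (R : realType) (d : nat)
    (nrm : 'rV[R]_d -> R) (k : nat) : Prop :=
  sphere_cover nrm k /\ forall j, sphere_cover nrm j -> (k <= j)%N.

(* The default value 0 is never used when nrm is a norm,
   see sphere_covering_numberP. *)
Definition sphere_covering_number (R : realType) (d : nat)
    (nrm : 'rV[R]_d -> R) : nat :=
  xget 0%N [set k | is_sphere_covering_number nrm k].

Definition finite_moment (R : realType) (d : nat) (nrm : 'rV[R]_d -> R) (p : R)
    (mu : probability (borel_rV R d) R) : Prop :=
  (\int[mu]_xi ((nrm xi `^ p)%:E) < +oo)%E.

(* The neutral element +oo of the minimum is irrelevant as soon as N > 0. *)
Definition quantization_error (R : realType) (d : nat) (nrm : 'rV[R]_d -> R)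
    (N : nat) (p : R) (mu : probability (borel_rV R d) R)
    (x : 'I_N -> 'rV[R]_d) : \bar R :=
  ((\int[mu]_xi \big[Order.min/+oo]_(i < N) ((nrm (xi - x i) `^ p)%:E))
     `^ p^-1)%E.

Section sphere_covering_number_finite.
Variables (R : realType) (d : nat) (nrm : 'rV[R]_d -> R).
Hypothesis hnrm : is_norm nrm.

Let nrmD x y : nrm (x + y) <= nrm x + nrm y. Proof. by case: hnrm. Qed.
Let nrmZ (a : R) x : nrm (a *: x) = `|a| * nrm x. Proof. by case: hnrm. Qed.
Let nrm_eq0 x : nrm x = 0 -> x = 0. Proof. by case: hnrm => ? ? h /h. Qed.

Let nrm0 : nrm 0 = 0.
Proof. by rewrite -(scale0r 0) nrmZ normr0 mul0r. Qed.

Let nrmN x : nrm (- x) = nrm x.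
Proof. by rewrite -scaleN1r nrmZ normrN1 mul1r. Qed.

Let nrm_ge0 x : 0 <= nrm x.
Proof. by have := nrmD x (- x); rewrite subrr nrm0 nrmN -mulr2n pmulrn_lge0. Qed.

Let nrm_sum (F : 'I_d -> 'rV[R]_d) : nrm (\sum_i F i) <= \sum_i nrm (F i).
Proof.
elim/big_ind2 : _ => [|a b a' b' h h'|//]; first by rewrite nrm0.
by apply: le_trans (nrmD _ _) _; exact: lerD.
Qed.

Let M : R := 1 + \sum_(i < d) nrm (delta_mx 0 i).

Let M_gt0 : 0 < M.
Proof. by rewrite ltr_pwDl// sumr_ge0. Qed.

Let nrm_le x : nrm x <= M * `|x|.
Proof.
rewrite {1}(row_sum_delta x); apply: (le_trans (nrm_sum _)).
rewrite mulrDl mul1r -[leLHS]add0r lerD// mulr_suml ler_sum// => i _.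
rewrite nrmZ mulrC ler_wpM2l//.
rewrite [leRHS]/Num.norm /= mx_normrE.
by apply/bigmax_geP; right => /=; exists (0, i).
Qed.

Let nrm_continuous : continuous nrm.
Proof.
have fx (x : 'rV[R]_d) : Filter (nbhs x) by exact: nbhs_filter.
move=> x; apply/(@cvgrPdist_le _ _ _ _ (fx x)) => e e0.
have /(@cvgrPdist_le _ _ _ _ (fx x)) /(_ (M^-1 * e)) : y @[y --> x] --> x.
  exact: cvg_id.
rewrite mulr_gt0 ?invr_gt0// => /(_ isT); apply: filterS => y xy.
have le1 a b : nrm a - nrm b <= nrm (a - b).
  by rewrite lerBlDr -{1}(subrK b a).
apply: (@le_trans _ _ (nrm (x - y))).
  by rewrite ler_norml le1 andbT lerNl opprB -(nrmN (x - y)) opprB.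
by apply: (le_trans (nrm_le _)); rewrite -ler_pdivlMl.
Qed.

Let sup_sphere_compact : compact [set x : 'rV[R]_d | `|x| = 1].
Proof.
apply: bounded_closed_compact.
  exists 1; split; first exact: num_real.
  by move=> y y1 x /= ->; exact: ltW.
rewrite (_ : mkset _ = Num.norm @^-1` [set (1 : R)])//.
apply: closed_comp; last exact: closed_eq.
by move=> x _; exact: norm_continuous.
Qed.

Let nrm_ge : exists2 m : R, 0 < m & forall x, m * `|x| <= nrm x.
Proof.
have [[x0 x01]|S0] := pselect ([set x : 'rV[R]_d | `|x| = 1] !=set0); last first.
  exists 1 => // x; have [->|x0] := eqVneq x 0; first by rewrite normr0 mulr0.
  exfalso; apply: S0; exists (`|x|^-1 *: x) => /=.
  by rewrite normrZ normfV normr_id mulVf// normr_eq0.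
have [||c + hc] := @compact_EVT_min _ R nrm _ _ sup_sphere_compact.
- by exists x0.
- by apply: continuous_subspaceT; exact: nrm_continuous.
rewrite inE /= => c1; exists (nrm c).
  rewrite lt_neqAle nrm_ge0 andbT eq_sym; apply/eqP => /nrm_eq0 c0.
  by move: c1; rewrite c0 normr0 => /eqP; rewrite eq_sym oner_eq0.
move=> x; have [->|x0'] := eqVneq x 0; first by rewrite normr0 mulr0 nrm0.
have nx : 0 < `|x| by rewrite normr_gt0.
have := hc (`|x|^-1 *: x); rewrite inE /= nrmZ normfV normr_id.
rewrite ler_pdivlMl// mulrC; apply.
by rewrite normrZ normfV normr_id mulVf// gt_eqF.
Qed.

Let unit_sphere_compact : compact (unit_sphere nrm).
Proof.
have [m m0 hm] := nrm_ge.
apply: bounded_closed_compact.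
  exists m^-1; split; first exact: num_real.
  move=> y ym x /= x1; apply: ltW; apply: le_lt_trans ym.
  by rewrite -[leRHS]mulr1 ler_pdivlMl// -x1.
rewrite (_ : unit_sphere nrm = nrm @^-1` [set 1])//.
apply: closed_comp; last exact: closed_eq.
by move=> x _; exact: nrm_continuous.
Qed.

Lemma sphere_cover_finite : exists k, sphere_cover nrm k.
Proof.
have := unit_sphere_compact; rewrite compact_cover.
move=> /(_ _ (unit_sphere nrm) (fun a => [set x | nrm (x - a) < 1])) [].
- move=> a _; rewrite (_ : mkset _ =
    (fun x => nrm (x - a)) @^-1` [set t | t < 1])//.
  apply: open_comp; last exact: open_lt.
  move=> x _; have xa : y - a @[y --> x] --> x - a.
    by apply: (@cvgB _ _ _ _ (nbhs_filter x)); [exact: cvg_id|exact: cvg_cst].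
  have h := cvg_comp _ nrm xa (@nrm_continuous (x - a)).
  exact: h.
- by move=> x Sx; exists x => //=; rewrite subrr nrm0.
move=> D DS cD; exists (size (finmap.enum_fset D)).
exists (fun i => nth 0 (finmap.enum_fset D) i); split.
  move=> i; have := DS (nth 0 (finmap.enum_fset D) i).
  by rewrite inE; apply; exact: mem_nth.
move=> x /cD [a /= aD xa].
have aD' : (index a (finmap.enum_fset D) < size (finmap.enum_fset D))%N.
  by rewrite index_mem.
exists (Ordinal aD') => //=; rewrite /closed_unit_ball/= nth_index//.
exact: ltW.
Qed.

Lemma sphere_covering_numberP :
  is_sphere_covering_number nrm (sphere_covering_number nrm).
Proof.
rewrite /sphere_covering_number; case: xgetP => [k _ //|no].
have ex : exists k, `[< sphere_cover nrm k >].
  by have [k hk] := sphere_cover_finite; exists k; exact/asboolP.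
case: (ex_minnP ex) => k /asboolP hk kmin; exfalso; apply: (no k).
by split => // j /asboolP; exact: kmin.
Qed.

End sphere_covering_number_finite.

(* Main.v *)
Require Import Defs.
From HB Require Import structures.
From mathcomp Require Import all_boot all_order all_algebra sesquilinear.
From mathcomp Require Import all_classical all_reals all_analysis.
From mathcomp Require Import measurable_realfun ring lra.

(** For suitable [a_1, ..., a_k] with [k < N], the function
    [phi xi = min_i |xi - a_i|^p - min (|xi|^p, min_i |xi - a_i|^p)] is
    continuous, nonnegative, positive at [0], and vanishes for large [|xi|]: the
    sphere covering (or, in the Euclidean case, a simplex around [0]) provides
    for each large [xi] some [a_i] at least as close to [xi] as [0].  Both
    minima come from configurations of at most [N] points, so the constant [C]
    cancels, and every [phi ((xi - a) / t)] has the same integral under [mu]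
    and [nu].

    Translates of [phi] along a lattice cover the space with bounded overlap.
    Hence there is [kappa < 1] such that every compactly supported continuous
    [f] with [|f| <= b] is within [kappa b] of a combination of functions
    [phi ((xi - a) / t)], with coefficients proportional to the values of [f].
    Therefore [|mu f - nu f| <= 2 b], which holds for all such [f] and [b],
    self-improves to [2 kappa^n b] for all [n], so that [mu f = nu f]. *)

Set Implicit Arguments.
Unset Strict Implicit.
Unset Printing Implicit Defensive.

Import Order.TTheory GRing.Theory Num.Theory.
Import numFieldNormedType.Exports.

Local Open Scope classical_set_scope.
Local Open Scope ring_scope.

(** * Compactly supported continuous functions *)

Section compactly_supported.
Variables (R : realType) (d : nat).
Local Notation V := 'rV[R]_d.

(** In finite dimension, vanishing outside a ball is the same as having compact support. The bound
    [M] may be negative. *)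
Definition compactly_supported (f : V -> R) : Prop :=
  continuous f /\ exists M, forall x, M < `|x| -> f x = 0.

Lemma continuous_measurable_rV (f : V -> R) :
  continuous f -> measurable_fun setT (f : borel_rV R d -> R).
Proof.
move=> /continuousP cf; apply: (measurability _ (RGenOpens.measurableE R)).
move=> _ [_ [a [b ->] <-]]; rewrite setTI; apply: sub_sigma_algebra.
exact/cf/interval_open.
Qed.

Lemma bounded_continuous_integrable (mu : probability (borel_rV R d) R)
    (f : V -> R) (c : R) : continuous f -> (forall x, `|f x| <= c) ->
  mu.-integrable setT (EFin \o (f : borel_rV R d -> R)).
Proof.
move=> cf fc; apply: measurable_bounded_integrable => //.
- by rewrite [ltLHS](@probability_setT _ _ _ mu) ltry.
- exact: continuous_measurable_rV.
- exists c; split; first exact: num_real.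
  by move=> y cy x _; apply: le_trans (ltW cy).
Qed.

Lemma closed_ball_rV_compact (M : R) : compact [set x : V | `|x| <= M].
Proof.
apply: bounded_closed_compact.
  exists M; split; first exact: num_real.
  by move=> y My x /= xM; apply: le_trans (ltW My).
rewrite (_ : mkset _ = Num.norm @^-1` [set t : R | t <= M])//.
apply: closed_comp; last exact: closed_le.
by move=> x _; exact: norm_continuous.
Qed.

(** The pairs of a large ball on which [f] jumps by at least [e] form a compact set [P]. The
    distance of the two entries attains a positive minimum on [P], and this minimum, capped by 1,
    serves as [r]. *)
Lemma compactly_supported_unif_continuous (f : V -> R) (e : R) : 0 < e ->
  compactly_supported f ->
  exists2 r : R, 0 < r & forall x y, `|x - y| < r -> `|f x - f y| < e.
Proof.
move=> e0 [cf [M fM]].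
pose K := [set x : V | `|x| <= M + 1].
pose P := (K `*` K) `&` [set z : V * V | e <= `|f z.1 - f z.2|].
have cfst : continuous (fun z : V * V => f z.1).
  move=> z; apply: (@continuous_comp _ _ _ fst f); first exact: cvg_fst.
  exact: cf.
have csnd : continuous (fun z : V * V => f z.2).
  move=> z; apply: (@continuous_comp _ _ _ snd f); first exact: cvg_snd.
  exact: cf.
have cP : compact P.
  apply: compact_closedI.
    by apply: compact_setX; exact: closed_ball_rV_compact.
  rewrite (_ : mkset _ =
    (fun z => `|f z.1 - f z.2|) @^-1` [set t : R | e <= t])//.
  apply: closed_comp; last exact: closed_ge.
  by move=> z _; apply: cvg_norm; apply: cvgB; [exact: cfst|exact: csnd].
(* A close pair with a jump has an entry in the ball of radius [M], since otherwise both values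
   vanish; the other entry is then in the ball of radius [M + 1]. *)
have PE r x y : r <= 1 -> `|x - y| < r -> ~ P (x, y) -> `|f x - f y| < e.
  move=> r1 xyr nP; rewrite ltNge; apply/negP => efxy; apply: nP.
  have xy1 : `|x - y| < 1 by exact: lt_le_trans r1.
  have [xM|Mx] := leP `|x| M.
    split => //; split; rewrite /K /=; first by rewrite (le_trans xM)// lerDl.
    rewrite -(subrK x y) (le_trans (ler_normD _ _))// addrC lerD//.
    by rewrite distrC ltW.
  have [yM|My] := leP `|y| M.
    split => //; split; rewrite /K /=; last by rewrite (le_trans yM)// lerDl.
    by rewrite -(subrK y x) (le_trans (ler_normD _ _))// addrC lerD// ltW.
  by move: efxy; rewrite !fM// subrr normr0 leNgt e0.
have [P0|nP0] := pselect (P !=set0); last first.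
  exists 1 => // x y xy1; apply: (PE 1) => //= Pxy.
  by apply: nP0; exists (x, y).
have [|[u v] uvP uvmin] :=
  @compact_EVT_min _ R (fun z : V * V => `|z.1 - z.2|) _ P0 cP.
  apply: continuous_subspaceT => z; apply: cvg_norm; apply: cvgB.
    exact: cvg_fst.
  exact: cvg_snd.
have uv0 : 0 < `|u - v|.
  rewrite normr_gt0 subr_eq0; apply/eqP => uv.
  by move: uvP; rewrite inE uv => -[_ /=]; rewrite subrr normr0 leNgt e0.
exists (Num.min 1 `|u - v|); first by rewrite lt_min ltr01.
move=> x y xy; apply: (PE _ _ _ _ xy) => [|Pxy]; first by rewrite ge_min lexx.
by move: xy; rewrite lt_min => /andP[_]; rewrite ltNge (uvmin (x, y))// inE.
Qed.

End compactly_supported.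

(** * Approximation by lattice translates of a bump *)

Section lattice.
Variables (R : realType) (d : nat).
Local Notation V := 'rV[R]_d.

Lemma rV_normP (x : V) (M : R) : 0 <= M ->
  (forall i, `|x ord0 i| <= M) -> `|x| <= M.
Proof.
move=> M0 xM; rewrite [leLHS]/Num.norm /= mx_normrE.
by apply/bigmax_leP; split => // -[i j] _ /=; rewrite ord1.
Qed.

Lemma rV_coord_le (x : V) i : `|x ord0 i| <= `|x|.
Proof.
rewrite [leRHS]/Num.norm /= mx_normrE.
by apply/bigmax_geP; right => /=; exists (ord0, i).
Qed.

(** The part of the lattice of mesh [h] in the cube of half-side [h * m]: the indices run from 0 to
    [2m] and are recentred by [m], which keeps the index type finite. *)
Definition grid_point (h : R) (m : nat) (w : {ffun 'I_d -> 'I_(m.*2.+1)}) : V :=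
  \row_i (h * ((w i)%:R - m%:R)).

(** The shifted coordinates [x_i / h + m] lie between 0 and [2m], so rounding them down gives
    admissible indices. *)
Lemma grid_dense (h : R) (m : nat) (x : V) : 0 < h -> `|x| <= h * m%:R ->
  exists w : {ffun 'I_d -> 'I_(m.*2.+1)}, `|x - grid_point h w| <= h.
Proof.
move=> h0 xm.
have coord i : - (h * m%:R) <= x ord0 i <= h * m%:R.
  by rewrite -ler_norml; exact: le_trans (rV_coord_le x i) xm.
pose k i := Num.truncn (x ord0 i / h + m%:R).
have kge0 i : 0 <= x ord0 i / h + m%:R.
  have /andP[+ _] := coord i.
  by rewrite -mulrN -ler_pdivlMl// mulrC => ?; rewrite -lerBlDr sub0r.
have k_itv i : (k i)%:R <= x ord0 i / h + m%:R < (k i).+1%:R.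
  exact: truncn_itv.
have km i : (k i < m.*2.+1)%N.
  rewrite ltnS -(ler_nat R); have /andP[+ _] := k_itv i.
  move=> /le_trans; apply; rewrite -addnn natrD lerD2r.
  by rewrite ler_pdivrMr// mulrC; have /andP[] := coord i.
exists [ffun i => Ordinal (km i)]; apply: rV_normP; first exact: ltW.
move=> i; rewrite !mxE ffunE /=.
have -> : x ord0 i - h * ((k i)%:R - m%:R) =
    h * (x ord0 i / h + m%:R - (k i)%:R) by field; rewrite gt_eqF.
have /andP[k1 k2] := k_itv i.
rewrite normrM (gtr0_norm h0) ler_piMr ?(ltW h0)// ger0_norm ?subr_ge0//.
by rewrite lerBlDl; move: k2; rewrite -natr1; exact: ltW.
Qed.

(* Reducing the coordinates modulo [K] is injective on the grid points in a ball
   of diameter at most [h * K]. *)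
Lemma card_grid_ball (h T : R) (m K : nat) (x : V) : 0 < h ->
  2 * T <= h * K%:R ->
  (#|[set w : {ffun 'I_d -> 'I_(m.*2.+1)} | (`|x - grid_point h w| < T)%R]%SET|
     <= K ^ d)%N.
Proof.
move=> h0 hTK.
have [K0|K0] := posnP K.
  rewrite (_ : finset _ = finset.set0) ?cards0//.
  apply/setP => w; rewrite !inE; apply/negbTE; rewrite -leNgt.
  by move: hTK; rewrite K0 mulr0 pmulr_rle0// => /le_trans; apply.
pose red (w : {ffun 'I_d -> 'I_(m.*2.+1)}) : {ffun 'I_d -> 'I_K} :=
  [ffun i => Ordinal (ltn_pmod (w i) K0)].
rewrite -[X in (_ <= X ^ _)%N]card_ord -[X in (_ <= _ ^ X)%N]card_ord.
rewrite -card_ffun.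
rewrite -(@card_in_imset _ _ red) ?max_card// => w w'.
rewrite !inE => xw xw' ww'.
apply/ffunP => i; apply/val_inj => /=.
have : w i = w' i %[mod K].
  by move/ffunP: ww' => /(_ i); rewrite !ffunE => /(congr1 val).
have lt_wK (u v : {ffun 'I_d -> 'I_(m.*2.+1)}) : `|x - grid_point h u| < T ->
    `|x - grid_point h v| < T -> (u i < v i + K)%N.
  move=> xu xv; have : `|grid_point h u - grid_point h v| < 2 * T.
    have -> : grid_point h u - grid_point h v =
        (x - grid_point h v) - (x - grid_point h u).
      by rewrite opprB [RHS]addrC addrA subrK.
    by rewrite (le_lt_trans (ler_normB _ _))// mulr_natl mulr2n ltrD.
  move=> /lt_le_trans /(_ hTK) /(le_lt_trans (rV_coord_le _ i)).
  rewrite !mxE -mulrBr opprB addrA subrK normrM (gtr0_norm h0) ltr_pM2l//.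
  by move=> /(le_lt_trans (ler_norm _)); rewrite ltrBlDl -natrD ltr_nat.
wlog le_ww : w w' xw xw' {ww'} / (w i <= w' i)%N.
  move=> H wm; have [ww|/ltnW ww] := leqP (w i) (w' i); first exact: H.
  by apply/esym; apply: H.
(* The difference [w' i - w i] is a multiple of [K] and, by [lt_wK], less than [K]; hence it is
   0. *)
move=> /eqP; rewrite eq_sym eqn_mod_dvd// => /dvdnP[q qE].
have := lt_wK _ _ xw' xw; rewrite -ltn_subLR// qE.
case: q qE => [|q] qE; first by rewrite mul0n in qE; move=> _; apply/eqP;
  rewrite eqn_leq le_ww /= -subn_eq0 qE.
by rewrite mulSn ltnNge leq_addr.
Qed.

(** Weights [f (z w) / B'] are put on bumps centred at grid points, where [B'] bounds the sum [S] of
    all bumps. Where [f] may be nonzero, [S] is at least [c], so a fixed fraction [c / B'] of [f] is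
    captured, up to the oscillation of [f] on the support of one bump. Fine bumps make this
    oscillation cost at most half of the gain. *)
Lemma lattice_approx (phi : V -> R) (c T B r : R) : 0 < c -> 0 < r ->
  (forall x, 0 <= phi x <= B) -> (forall x, T <= `|x| -> phi x = 0) ->
  (forall x, `|x| <= r -> c <= phi x) ->
  exists2 kappa : R, 0 < kappa < 1 &
  forall (f : V -> R) (b : R), compactly_supported f ->
    0 < b -> (forall x, `|f x| <= b) ->
  exists (I : finType) (t : R) (l : I -> R) (z : I -> V), 0 < t /\
    forall x, `|f x - \sum_i l i * phi (t^-1 *: (x - z i))| <= kappa * b.
Proof.
move=> c0 r0 phiB phiT phic.
have T0 : 0 < T.
  rewrite ltNge; apply/negP => T0.
  have := phic 0; rewrite normr0 phiT ?normr0// => /(_ (ltW r0)).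
  by rewrite leNgt c0.
have cB : c <= B.
  have /andP[_] := phiB 0; apply: le_trans; apply: phic.
  by rewrite normr0 ltW.
have B0 : 0 < B by exact: lt_le_trans cB.
(* At any scale [t], at most [K ^ d] bumps of radius [t * T] centred on a grid of mesh [t * r]
   overlap at a point. As [K] depends on [T] and [r] only, [kappa] does not depend on [f]. *)
pose K := (Num.truncn (2 * T / r)).+1.
have KP : 2 * T <= r * K%:R.
  by rewrite -ler_pdivrMl// mulrC; apply/ltW/truncnS_gt.
pose B' := B * (K ^ d)%:R.
have BB' : B <= B' by rewrite ler_peMr ?(ltW B0)// ler1n expn_gt0.
have B'0 : 0 < B' by exact: lt_le_trans BB'.
have cB' : c / B' <= 1 by rewrite ler_pdivrMr// mul1r (le_trans cB).
have cB'0 : 0 < c / B' by rewrite divr_gt0.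
exists (1 - c / B' / 2).
  by move: cB' cB'0; set q := c / B'; clearbody q => *; apply/andP; split; lra.
move=> f b fcs b0 fb.
have e0 : 0 < c / B' / 2 * b by rewrite mulr_gt0// divr_gt0.
have [del del0 fdel] := compactly_supported_unif_continuous e0 fcs.
have [M fM] : exists M, forall x, M < `|x| -> f x = 0 by case: fcs.
(* At this scale each bump vanishes at distance [del] from its centre, the radius within which [f]
   is nearly constant. *)
pose t := del / T.
have t0 : 0 < t by rewrite divr_gt0.
have h0 : 0 < t * r by rewrite mulr_gt0.
pose m := (Num.truncn (M / (t * r))).+1.
have Mm : M <= (t * r) * m%:R.
  by rewrite -ler_pdivrMl// mulrC; apply/ltW/truncnS_gt.
pose z := @grid_point (t * r) m.
pose ph (w : {ffun 'I_d -> 'I_(m.*2.+1)}) x := phi (t^-1 *: (x - z w)).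
have ph_ge0 w x : 0 <= ph w x by have /andP[] := phiB (t^-1 *: (x - z w)).
have ph_eq0 w x : del <= `|x - z w| -> ph w x = 0.
  move=> xw; apply: phiT; rewrite normrZ gtr0_norm ?invr_gt0//.
  by rewrite ler_pdivlMl// divfK ?gt_eqF.
exists {ffun 'I_d -> 'I_(m.*2.+1)}, t, (fun w => f (z w) / B'), z.
split => // x.
pose S := \sum_w ph w x.
have SB' : S <= B'.
  rewrite /S (bigID (fun w => `|x - z w| < del)) /= [X in _ + X]big1 ?addr0.
    apply: (@le_trans _ _ (\sum_(w | `|x - z w| < del) B)).
      by apply: ler_sum => w _; have /andP[] := phiB (t^-1 *: (x - z w)).
    rewrite sumr_const -[leLHS]mulr_natr ler_wpM2l ?(ltW B0)// ler_nat.
    apply: leq_trans (@card_grid_ball _ del m K x h0 _); last first.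
      have -> : del = t * T by rewrite divfK// gt_eqF.
      by rewrite mulrCA -mulrA ler_pM2l.
    by apply/eq_leq/eq_card => w; rewrite !inE.
  by move=> w; rewrite -leNgt; exact: ph_eq0.
have S0 : 0 <= S by apply: sumr_ge0.
have Sc : `|x| <= M -> c <= S.
  move=> xM; have [w xw] := grid_dense h0 (le_trans xM Mm).
  apply: (@le_trans _ _ (ph w x)); last first.
    by rewrite /S (bigD1 w)//= lerDl sumr_ge0.
  apply: phic; rewrite normrZ gtr0_norm ?invr_gt0//.
  by rewrite ler_pdivrMl.
(* The first term is the part of [f x] that is not captured, the second the oscillation of [f]. *)
have -> : f x - \sum_w f (z w) / B' * ph w x =
    f x * (1 - S / B') + (\sum_w (f x - f (z w)) * ph w x) / B'.
  under [X in _ = _ + X / _]eq_bigr do rewrite mulrBl.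
  rewrite sumrB -mulr_sumr -/S mulrBr mulr1 mulrBl mulrA addrA subrK.
  by congr (_ - _); rewrite mulr_suml; apply: eq_bigr => w _; rewrite mulrAC.
have SB1 : S / B' <= 1 by rewrite ler_pdivrMr// mul1r.
have osc : `|(\sum_w (f x - f (z w)) * ph w x) / B'| <= c / B' / 2 * b.
  rewrite normrM (gtr0_norm (_ : 0 < B'^-1)) ?invr_gt0//.
  apply: (@le_trans _ _ (c / B' / 2 * b * S / B')); last first.
    by rewrite -mulrA ler_piMr// ltW.
  rewrite ler_wpM2r ?invr_ge0 ?(ltW B'0)// mulr_sumr.
  apply: le_trans (ler_norm_sum _ _ _) _; apply: ler_sum => w _.
  rewrite normrM (ger0_norm (ph_ge0 _ _)).
  have [xw|xw] := leP del `|x - z w|; first by rewrite ph_eq0// !mulr0.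
  by rewrite ler_wpM2r// ltW// fdel.
apply: le_trans (ler_normD _ _) _.
have [xM|xM] := leP `|x| M; last first.
  rewrite [X in `|X * (1 - _)|]fM// mul0r normr0 add0r.
  rewrite (le_trans osc)// ler_pM2r//.
  by move: cB'; set q := c / B'; clearbody q => *; lra.
apply: (@le_trans _ _ (b * (1 - c / B') + c / B' / 2 * b)); last by nra.
rewrite lerD// normrM ler_pM//.
rewrite ger0_norm ?subr_ge0// lerD2l lerN2 ler_pM2r ?invr_gt0//.
exact: Sc.
Qed.

End lattice.

(** * Equality of integrals by iterated approximation *)

Lemma continuous_scale_translate (R : realType) (W : normedModType R) (t : R)
    (a : W) : continuous (fun x => t *: (x - a)).
Proof.
by move=> x; apply: cvgZr; apply: cvgB; [exact: cvg_id|exact: cvg_cst].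
Qed.

Section integrals.
Variables (R : realType) (d : nat).
Local Notation V := 'rV[R]_d.
Implicit Types mu nu : probability (borel_rV R d) R.

Lemma compactly_supported_bump (phi : V -> R) (T t : R) (a : V) : 0 < t ->
  continuous phi -> (forall x, T <= `|x| -> phi x = 0) ->
  compactly_supported (fun x => phi (t^-1 *: (x - a))).
Proof.
move=> t0 cphi phiT; split.
  move=> x; apply: (@continuous_comp _ _ _ (fun x : V => t^-1 *: (x - a)) phi).
    exact: continuous_scale_translate.
  exact: cphi.
exists (t * T + `|a|) => x xT; apply: phiT.
rewrite normrZ gtr0_norm ?invr_gt0// ler_pdivlMl//.
have := ler_normB (x - a) (- a); rewrite opprK subrK normrN.
by move: xT; lra.
Qed.

Lemma compactly_supportedD (f g : V -> R) : compactly_supported f ->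
  compactly_supported g -> compactly_supported (fun x => f x + g x).
Proof.
move=> [cf [M fM]] [cg [M' gM]]; split.
  by move=> x; apply: (@continuousD _ _ _ f g); [exact: cf|exact: cg].
exists (Num.max M M') => x; rewrite gt_max => /andP[xM xM'].
by rewrite fM// gM// addr0.
Qed.

Lemma compactly_supportedZ (f : V -> R) (l : R) : compactly_supported f ->
  compactly_supported (fun x => l * f x).
Proof.
move=> [cf [M fM]]; split.
  move=> x; apply: (@continuousM _ _ (fun=> l) f); last exact: cf.
  exact: cst_continuous.
by exists M => x xM; rewrite fM// mulr0.
Qed.

Lemma compactly_supported_sum (I : Type) (s : seq I) (f : I -> V -> R) :
  (forall i, compactly_supported (f i)) ->
  compactly_supported (fun x => \sum_(i <- s) f i x).
Proof.
move=> fcs; elim: s => [|i s IHs].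
  under eq_fun do rewrite big_nil; split.
    by move=> x; exact: cst_continuous.
  by exists 0.
by under eq_fun do rewrite big_cons; exact: compactly_supportedD.
Qed.

Lemma compactly_supported_bounded (f : V -> R) : compactly_supported f ->
  exists b, forall x, `|f x| <= b.
Proof.
move=> [cf [M fM]].
have M0 : [set x : V | `|x| <= `|M| ] !=set0 by exists 0; rewrite /= normr0.
have cnf : continuous (fun x => `|f x|).
  move=> x; apply: (@continuous_comp _ _ _ f Num.norm); first exact: cf.
  exact: norm_continuous.
have [c _ cmax] := compact_EVT_max M0 (@closed_ball_rV_compact R d `|M|)
  (continuous_subspaceT cnf).
exists `|f c| => x; have [xM|Mx] := leP `|x| M; last by rewrite fM// normr0.
by apply: cmax; rewrite inE /= (le_trans xM)// ler_norm.
Qed.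

Lemma compactly_supported_integrable mu (f : V -> R) : compactly_supported f ->
  mu.-integrable setT (EFin \o (f : borel_rV R d -> R)).
Proof.
move=> fcs; have [b fb] := compactly_supported_bounded fcs.
by apply: bounded_continuous_integrable fb; case: fcs.
Qed.


Lemma Rintegral_combination mu (I : Type) (s : seq I) (l : I -> R)
    (g : I -> V -> R) : (forall i, compactly_supported (g i)) ->
  \int[mu]_x (\sum_(i <- s) l i * g i x) = \sum_(i <- s) l i * \int[mu]_x g i x.
Proof.
move=> gcs; have lgcs i := compactly_supportedZ (l i) (gcs i).
elim: s => [|i s IHs].
  rewrite big_nil; under eq_Rintegral do rewrite big_nil.
  by rewrite Rintegral_cst// mul0r.
rewrite big_cons -IHs; under eq_Rintegral do rewrite big_cons.
rewrite RintegralD//; first rewrite RintegralZl//.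
- exact: compactly_supported_integrable.
- exact: compactly_supported_integrable.
- by apply: compactly_supported_integrable; exact: compactly_supported_sum.
Qed.

Lemma normr_Rintegral_le mu (f : V -> R) (b : R) : compactly_supported f ->
  (forall x, `|f x| <= b) -> `|\int[mu]_x (f x : R)| <= b.
Proof.
move=> fcs fb; have fint := compactly_supported_integrable mu fcs.
apply: le_trans (le_normr_Rintegral _ fint) _ => //.
have -> : b = \int[mu]_x b.
  by rewrite Rintegral_cst// [X in fine X](@probability_setT _ _ _ mu) mulr1.
apply: le_Rintegral => //.
- exact: (integrable_norm fint).
- by apply: finite_measure_integrable_cst.
Qed.

(** Subtracting from [g] a combination of bumps leaves the difference of its two integrals unchanged
    and shrinks its bound by the factor [kap]. Starting from the trivial estimate [2 * b],
    repetition drives the difference to 0. *)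
Lemma compactly_supported_Rintegral_eq mu nu (phi : V -> R) (c T B r : R) :
  continuous phi -> 0 < c -> 0 < r ->
  (forall x, 0 <= phi x <= B) -> (forall x, T <= `|x| -> phi x = 0) ->
  (forall x, `|x| <= r -> c <= phi x) ->
  (forall (t : R) (a : V), 0 < t ->
    \int[mu]_x phi (t^-1 *: (x - a)) = \int[nu]_x phi (t^-1 *: (x - a))) ->
  forall f : V -> R, compactly_supported f ->
    \int[mu]_x (f x : R) = \int[nu]_x (f x : R).
Proof.
move=> cphi c0 r0 phiB phiT phic Ephi f fcs.
have [kap /andP[kap0 kap1] approx] := lattice_approx c0 r0 phiB phiT phic.
(* The induction hypothesis has to cover all functions and bounds: it is applied to [g - h] with the
   bound [kap * b]. *)
have key n : forall (g : V -> R) (b : R), compactly_supported g -> 0 < b ->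
    (forall x, `|g x| <= b) ->
    `|\int[mu]_x (g x : R) - \int[nu]_x (g x : R)| <= 2 * b * kap ^+ n.
  elim: n => [g b gcs b0 gb|n IHn g b gcs b0 gb].
    rewrite expr0 mulr1 (le_trans (ler_normB _ _))// mulr_natl mulr2n.
    by rewrite lerD// normr_Rintegral_le.
  have [I [t [l [z [t0 app]]]]] := approx g b gcs b0 gb.
  pose h x := \sum_i l i * phi (t^-1 *: (x - z i)).
  have bumpcs i : compactly_supported (fun x => phi (t^-1 *: (x - z i))).
    exact: compactly_supported_bump phiT.
  have hcs : compactly_supported h.
    by apply: compactly_supported_sum => i; exact: compactly_supportedZ.
  have Eh : \int[mu]_x (h x : R) = \int[nu]_x (h x : R).
    rewrite !(Rintegral_combination _ _ _ bumpcs).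
    by apply: eq_bigr => i _; rewrite Ephi.
  have ghcs : compactly_supported (fun x => g x - h x).
    rewrite (_ : (fun x => _) = (fun x => g x + -1 * h x)).
      by apply: compactly_supportedD => //; exact: compactly_supportedZ.
    by apply/funext => x; rewrite mulN1r.
  have sub (m : probability (borel_rV R d) R) : \int[m]_x (g x - h x : R) =
      \int[m]_x (g x : R) - \int[m]_x (h x : R).
    by rewrite RintegralB//; exact: compactly_supported_integrable.
  have -> : \int[mu]_x (g x : R) - \int[nu]_x (g x : R) =
      \int[mu]_x (g x - h x : R) - \int[nu]_x (g x - h x : R).
    by rewrite !sub Eh opprB addrA subrK.
  rewrite exprS mulrA -(mulrA 2) (mulrC b); apply: IHn => //.
  exact: mulr_gt0.
have [b fb] := compactly_supported_bounded fcs.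
have b0 : 0 < `|b| + 1 by rewrite ltr_wpDl.
have {}fb x : `|f x| <= `|b| + 1.
  by rewrite (le_trans (fb x))// (le_trans (ler_norm _))// lerDl.
apply/eqP; rewrite -subr_eq0 -normr_le0.
have lim0 : 2 * (`|b| + 1) * kap ^+ n @[n --> \oo] --> (0 : R).
  rewrite -(mulr0 (2 * (`|b| + 1))); apply: cvgMr; apply: cvg_expr.
  by rewrite gtr0_norm.
rewrite -(cvg_lim _ lim0)//; apply: limr_ge.
  by apply/cvg_ex; eexists; exact: lim0.
by apply: nearW => n; exact: key.
Qed.

End integrals.

(** * Identification of the measures *)

Section distance.
Variables (R : realType) (W : normedModType R) (A : set W).
Hypothesis A0 : A !=set0.

(** Nonemptiness of [A] keeps [inf] away from its default value on the empty set. *)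
Definition distance (x : W) : R := inf [set `|x - y| | y in A].

Let has_lbound_distance x : has_lbound [set `|x - y| | y in A].
Proof. by exists 0 => _ [y _ <-]. Qed.

Let nonempty_distance x : [set `|x - y| | y in A] !=set0.
Proof. by have [a Aa] := A0; exists `|x - a|, a. Qed.

Lemma distance_le x y : A y -> distance x <= `|x - y|.
Proof. by move=> Ay; apply: ge_inf => //; exists y. Qed.

Lemma le_distance x r : (forall y, A y -> r <= `|x - y|) -> r <= distance x.
Proof. by move=> rA; apply: lb_le_inf => // _ [y Ay <-]; exact: rA. Qed.

Lemma distance_ge0 x : 0 <= distance x.
Proof. exact: le_distance. Qed.

Lemma distance_eq0 x : A x -> distance x = 0.
Proof.
move=> Ax; apply/eqP; rewrite eq_le distance_ge0 andbT.
by rewrite (le_trans (distance_le x Ax))// subrr normr0.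
Qed.

(** By the triangle inequality the distance to a set is 1-Lipschitz. *)
Lemma distance_continuous : continuous distance.
Proof.
have lip x y : distance x <= `|x - y| + distance y.
  rewrite -lerBlDl; apply: le_distance => z Az.
  rewrite lerBlDl (le_trans (distance_le x Az))//.
  by rewrite (le_trans _ (ler_normD _ _))// addrA subrK.
move=> x; apply/cvgrPdist_lt => e e0.
have := nbhsx_ballx x e e0; rewrite -ball_normE.
apply: filterS => y xy; apply: le_lt_trans xy.
rewrite ler_norml; have := lip x y; have := lip y x; rewrite distrC.
by move=> *; apply/andP; split; lra.
Qed.

End distance.

(** * Borel probabilities determined by compactly supported functions *)

Section determination.
Variables (R : realType) (d : nat).
Local Notation V := 'rV[R]_d.
Implicit Types mu nu : probability (borel_rV R d) R.

(** With [A n] the complement of [U] cut by the open ball of radius [n], the function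
    [min (1, n * distance (A n))] vanishes off [U] and off that ball. On [U] it is eventually equal
    to 1. *)
Lemma indicator_approx (U : set V) : (0 < d)%N -> open U ->
  exists f : nat -> V -> R,
    [/\ forall n, compactly_supported (f n),
        forall n x, 0 <= f n x <= 1
      & forall x, f n x @[n --> \oo] --> (\1_U x : R)].
Proof.
move=> d0 oU.
pose A n : set V := ~` (U `&` [set x | `|x| < n%:R]).
have A0 n : A n !=set0.
  (* This vector has sup norm at least [n] because there is a coordinate, by [0 < d]. *)
  exists (const_mx n%:R) => -[_ /=]; rewrite ltNge => /negP; apply.
  have := rV_coord_le (const_mx n%:R : V) (Ordinal d0).
  by rewrite mxE normr_nat.
exists (fun n x => Num.min 1 (n%:R * distance (A n) x)); split.
- move=> n; split.
    move=> x; apply: (@continuous_min _ _ (fun=> 1)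
      (fun x => n%:R * distance (A n) x)).
      exact: cst_continuous.
    apply: (@continuousM _ _ (fun=> n%:R) (distance (A n))).
      exact: cst_continuous.
    exact: (distance_continuous (A0 n)).
  exists n%:R => x nx; rewrite (distance_eq0 (A0 n)) ?mulr0//; last first.
    by move=> [_ /=]; rewrite ltNge (ltW nx).
  by apply/min_idPr.
- move=> n x; rewrite ge_min lexx andbT le_min ler01 mulr_ge0//.
  exact: (distance_ge0 (A0 n)).
- move=> x; rewrite indicE; have [xU|xU] := boolP (x \in U); last first.
    rewrite [X in X @ _ --> _](_ : _ = fun=> 0); first exact: cvg_cst.
    apply/funext => n; rewrite (distance_eq0 (A0 n)) ?mulr0.
      exact/min_idPr.
    by move=> [Ux _]; move: xU; rewrite mem_set.
  have /nbhs_ballP[r /= r0 xrU] : nbhs x U.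
    by apply: open_nbhs_nbhs; split => //; exact: set_mem.
  (* Beyond [|x| + r] the ball of radius [r] around [x] avoids [A n]; beyond [r^-1] the product
     [n * r] is at least 1. *)
  apply: cvg_near_cst; exists (Num.truncn (`|x| + r + r^-1)).+1 => //.
  move=> n /= nlarge; apply/min_idPl.
  have {}nlarge : `|x| + r + r^-1 < n%:R.
    by rewrite (lt_le_trans (truncnS_gt _))// ler_nat.
  have rV0 : 0 < r^-1 by rewrite invr_gt0.
  have rn : r <= distance (A n) x.
    apply: (le_distance (A0 n)) => // y; apply: contra_notP.
    move=> /negP; rewrite -ltNge => xy.
    split; first by apply: xrU; rewrite -ball_normE.
    rewrite /= -(subrK x y) (le_lt_trans (ler_normD _ _))// distrC.
    lra.
  apply: (@le_trans _ _ (r^-1 * r)); first by rewrite mulVf// gt_eqF.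
  apply: ler_pM => //; [exact: ltW|exact: ltW|].
  by rewrite ltW// (le_lt_trans _ nlarge)// lerDr addr_ge0// ltW.
Qed.

(** The open sets are stable under intersection and generate the Borel sets, so agreement on them
    suffices. The measure of an open set is the limit of integrals of the functions from
    [indicator_approx], by dominated convergence with the constant 1. *)
Lemma probability_eq_compactly_supported mu nu : (0 < d)%N ->
  (forall f : V -> R, compactly_supported f ->
    \int[mu]_x (f x : R) = \int[nu]_x (f x : R)) ->
  forall A : set (borel_rV R d), measurable A -> mu A = nu A.
Proof.
move=> d0 Ef A mA.
refine (@measure_unique _ R (borel_rV R d) (@open V) (fun=> setT)
  _ _ _ _ mu nu _ _ A mA) => //.
- exact: openI.
- by move=> _; exact: openT.
- by apply/seteqP; split => // x _; exists 0%N.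
- move=> U oU; have [f [fcs f01 fU]] := indicator_approx d0 oU.
  have mU : measurable (U : set (borel_rV R d)) by exact: sub_sigma_algebra.
  have cvgf (m : probability (borel_rV R d) R) :
      (\int[m]_x (f n x : R))%:E @[n --> \oo] --> m U.
    have -> : m U = (\int[m]_(x in setT) (\1_U x)%:E)%E.
      by rewrite integral_indic// setIT.
    rewrite [X in X @ _ --> _](_ : _ = fun n => (\int[m]_x (f n x)%:E)%E).
      apply: (@dominated_cvg _ _ _ m _ _ _ _ (cst 1%E)) => //.
      + move=> n; apply/measurable_EFinP; apply: continuous_measurable_rV.
        by have [] := fcs n.
      + by move=> x _; apply/cvg_EFin; [exact: nearW|exact: fU].
      + exact: finite_measure_integrable_cst.
      + move=> n x _; rewrite /= lee_fin; have /andP[f0 f1] := f01 n x.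
        by rewrite ger0_norm.
    apply/funext => n; rewrite /Rintegral fineK//.
    by apply: integrable_fin_num => //; exact: compactly_supported_integrable.
  have cmu : (\int[nu]_x (f n x : R))%:E @[n --> \oo] --> mu U.
    have := cvgf mu; rewrite (_ : (fun n => _) =
      (fun n => (\int[nu]_x (f n x : R))%:E))//.
    by apply/funext => n; rewrite Ef.
  exact: (cvg_unique _ cmu (cvgf nu)).
- by move=> _; rewrite [ltLHS](@probability_setT _ _ _ mu) ltry.
Qed.

End determination.

(** * Norms and nearest distances *)

(** Where [g] is positive, the power is differentiable. At a zero of [g], the bound [g y ^ p <= g y]
    for [g y <= 1] gives continuity; this uses [1 <= p]. *)
Lemma continuous_powR_comp (R : realType) (T : topologicalType) (g : T -> R)
    (p : R) : 1 <= p -> continuous g -> (forall x, 0 <= g x) ->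
  continuous (fun x => g x `^ p).
Proof.
move=> p1 cg g0 x; have p0 : p != 0 by rewrite gt_eqF// (lt_le_trans _ p1).
have [gx0|gx0] := eqVneq (g x) 0; last first.
  apply: (@continuous_comp _ _ _ g (fun a => a `^ p)); first exact: cg.
  apply: differentiable_continuous; apply/derivable1_diffP.
  by apply: derivable_powR; rewrite in_itv/= andbT lt_neqAle eq_sym gx0 g0.
apply/cvgrPdist_lt => e e0; rewrite gx0 powR0//.
have : \forall y \near x, `|g x - g y| < Num.min 1 e.
  have /cvgrPdist_lt := cg x; apply.
  by rewrite lt_min ltr01.
apply: filterS => y; rewrite gx0 !sub0r !normrN ger0_norm//.
rewrite ger0_norm ?powR_ge0// lt_min => /andP[gy1 gye].
have [gy0|gy0] := eqVneq (g y) 0; first by rewrite gy0 powR0.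
apply: le_lt_trans gye; apply: ge1r_powR => //.
by rewrite lt_neqAle eq_sym gy0 g0 ltW.
Qed.

Section norms.
Variables (R : realType) (d : nat) (nrm : 'rV[R]_d -> R).
Hypothesis hnrm : is_norm nrm.
Local Notation V := 'rV[R]_d.

Lemma nrmD x y : nrm (x + y) <= nrm x + nrm y.
Proof. by case: hnrm. Qed.

Lemma nrmZ a x : nrm (a *: x) = `|a| * nrm x.
Proof. by case: hnrm. Qed.

Lemma nrm_eq0 x : nrm x = 0 -> x = 0.
Proof. by case: hnrm => _ _; exact. Qed.

Lemma nrm0 : nrm 0 = 0.
Proof. by rewrite -(scale0r 0) nrmZ normr0 mul0r. Qed.

Lemma nrmN x : nrm (- x) = nrm x.
Proof. by rewrite -scaleN1r nrmZ normrN1 mul1r. Qed.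

Lemma nrmB x y : nrm (x - y) <= nrm x + nrm y.
Proof. by rewrite -(nrmN y) nrmD. Qed.

Lemma nrm_ge0 x : 0 <= nrm x.
Proof. by have := nrmB x x; rewrite subrr nrm0 -mulr2n pmulrn_lge0. Qed.

Lemma nrm_gt0 x : x != 0 -> 0 < nrm x.
Proof.
move=> x0; rewrite lt_neqAle nrm_ge0 eq_sym (contra_neq _ x0)//.
exact: nrm_eq0.
Qed.

Lemma nrm_le_norm : exists2 M : R, 0 < M & forall x, nrm x <= M * `|x|.
Proof.
exists (1 + \sum_(i < d) nrm (delta_mx 0 i)).
  by rewrite ltr_pwDl// sumr_ge0// => i _; exact: nrm_ge0.
move=> x; rewrite {1}(row_sum_delta x).
apply: (@le_trans _ _ (\sum_i nrm (x 0 i *: delta_mx 0 i))).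
  elim/big_ind2: _ => [|a b a' b' ab ab'|//]; first by rewrite nrm0.
  by apply: le_trans (nrmD _ _) _; exact: lerD.
rewrite mulrDl mul1r -[leLHS]add0r lerD// mulr_suml ler_sum// => i _.
by rewrite nrmZ mulrC ler_wpM2l ?nrm_ge0// rV_coord_le.
Qed.

Lemma nrm_continuous : continuous nrm.
Proof.
have [M M0 nrmM] := nrm_le_norm.
move=> x; apply/(@cvgrPdist_lt _ _ _ _ (nbhs_filter x)) => e e0.
have := nbhsx_ballx x (M^-1 * e) _; rewrite -ball_normE.
move=> /(_ (mulr_gt0 _ e0)); rewrite invr_gt0 => /(_ M0).
apply: filterS => y /= xy.
have dist a b : nrm a - nrm b <= nrm (a - b).
  by rewrite lerBlDr (le_trans _ (nrmD _ _))// subrK.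
apply: (@le_lt_trans _ _ (nrm (x - y))).
  by rewrite ler_norml dist andbT lerNl opprB -(nrmN (x - y)) opprB dist.
by apply: (le_lt_trans (nrmM _)); rewrite -ltr_pdivlMl.
Qed.

(** The constant is the minimum of [nrm] on the compact unit sphere of the sup norm, positive by
    definiteness; homogeneity extends the bound to all vectors. *)
Lemma norm_le_nrm : exists2 m : R, 0 < m & forall x, m * `|x| <= nrm x.
Proof.
pose S := [set x : V | `|x| = 1].
have [S0|S0] := pselect (S !=set0); last first.
  exists 1 => // x; have [->|x0] := eqVneq x 0.
    by rewrite normr0 mulr0 nrm0.
  exfalso; apply: S0; exists (`|x|^-1 *: x).
  by rewrite /S /= normrZ normfV normr_id mulVf// normr_eq0.
have cS : compact S.
  apply: (@subclosed_compact _ _ [set x : V | `|x| <= 1]).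
  - rewrite (_ : S = Num.norm @^-1` [set (1 : R)])//.
    apply: closed_comp; last exact: closed_eq.
    by move=> x _; exact: norm_continuous.
  - exact: closed_ball_rV_compact.
  - by move=> x /= ->.
have [u uS umin] := compact_EVT_min S0 cS (continuous_subspaceT nrm_continuous).
exists (nrm u).
  apply: nrm_gt0; rewrite -normr_gt0.
  by move: uS; rewrite inE => ->.
move=> x; have [->|x0] := eqVneq x 0; first by rewrite normr0 mulr0 nrm0.
have nx : 0 < `|x| by rewrite normr_gt0.
have := umin (`|x|^-1 *: x); rewrite inE /S /= nrmZ normfV normr_id.
rewrite ler_pdivlMl// mulrC; apply.
by rewrite normrZ normfV normr_id mulVf// gt_eqF.
Qed.

Section nearest.
Variable n : nat.
Implicit Types x y : 'I_n.+1 -> V.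

(** Starting the minimum at the distance to the first point keeps it real-valued without changing
    it. *)
Definition nearest_dist x (xi : V) : R :=
  \big[Order.min/nrm (xi - x ord0)]_(i < n.+1) nrm (xi - x i).

Lemma nearest_dist_le x xi i : nearest_dist x xi <= nrm (xi - x i).
Proof. by apply: bigmin_le_cond. Qed.

Lemma nearest_dist_attained x xi :
  exists i, nearest_dist x xi = nrm (xi - x i).
Proof.
rewrite /nearest_dist; elim/big_ind: _ => [|a b [i ->] [j ->]|i _].
- by exists ord0.
- by rewrite minEle; case: ifP => _; [exists i|exists j].
- by exists i.
Qed.

Lemma nearest_dist_ge0 x xi : 0 <= nearest_dist x xi.
Proof. by have [i ->] := nearest_dist_attained x xi; exact: nrm_ge0. Qed.

Lemma nearest_dist_continuous x : continuous (nearest_dist x).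
Proof.
have cnrm a : continuous (fun xi : V => nrm (xi - a)).
  move=> xi; apply: (@continuous_comp _ _ _ (fun xi : V => xi - a) nrm).
    have := @continuous_scale_translate _ V 1 a xi.
    by under eq_fun do rewrite scale1r.
  exact: nrm_continuous.
rewrite /nearest_dist; elim: (index_enum _) => [|i s IHs].
  by under eq_fun do rewrite big_nil; exact: cnrm.
under eq_fun do rewrite big_cons.
move=> xi; exact: (continuous_min (cnrm (x i) xi) (IHs xi)).
Qed.

(** All distances scale by [t]. Thus a rescaled and translated error function is again, up to a
    factor, that of a configuration with the same number of points. *)
Lemma nearest_dist_affine x (t : R) (a xi : V) : 0 < t ->
  nearest_dist (fun i => t *: x i + a) xi =
  t * nearest_dist x (t^-1 *: (xi - a)).
Proof.
move=> t0; have E i : nrm (xi - (t *: x i + a)) =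
    t * nrm (t^-1 *: (xi - a) - x i).
  rewrite -{2}(gtr0_norm t0) -nrmZ scalerBr scalerA divff ?gt_eqF// scale1r.
  by rewrite opprD addrA addrAC.
have [i Ei] := nearest_dist_attained (fun i => t *: x i + a) xi.
have [j Ej] := nearest_dist_attained x (t^-1 *: (xi - a)).
apply/eqP; rewrite eq_le {1}Ej -E nearest_dist_le Ei E ler_pM2l//.
exact: nearest_dist_le.
Qed.

Variables (p : R) (mu : probability (borel_rV R d) R).
Hypotheses (hp : 1 <= p) (hmu : finite_moment nrm p mu).

Let p0 : 0 < p. Proof. exact: lt_le_trans hp. Qed.

Lemma nearest_dist_powR_continuous x :
  continuous (fun xi => nearest_dist x xi `^ p).
Proof.
by apply: continuous_powR_comp => //;
  [exact: nearest_dist_continuous|exact: nearest_dist_ge0].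
Qed.

(** The outer power undoes the root because the integral is nonnegative, and the minimum commutes
    with the increasing map [u ^ p]. *)
Lemma quantization_errorE x :
  (quantization_error nrm p mu x `^ p)%E =
  (\int[mu]_xi (nearest_dist x xi `^ p)%:E)%E.
Proof.
rewrite /quantization_error -poweRrM mulVf ?gt_eqF// poweRe1; last first.
  apply: integral_ge0 => xi _; elim/big_ind: _ => //.
    by move=> a b a0 b0; rewrite le_min a0.
  by move=> i _; rewrite lee_fin powR_ge0.
apply: eq_integral => xi _; apply/eqP; rewrite eq_le; apply/andP; split.
  by have [i ->] := nearest_dist_attained x xi; exact: bigmin_le_cond.
apply/bigmin_geP; split => [|i _]; first by rewrite leey.
rewrite lee_fin ge0_ler_powR ?nnegrE ?nearest_dist_ge0 ?nrm_ge0 ?(ltW p0)//.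
exact: nearest_dist_le.
Qed.

Lemma nearest_dist_powR_integrable x : mu.-integrable setT
  (EFin \o ((fun xi => nearest_dist x xi `^ p) : borel_rV R d -> R)).
Proof.
have mnrm : measurable_fun setT ((fun xi => nrm xi `^ p) : borel_rV R d -> R).
  apply: continuous_measurable_rV; apply: continuous_powR_comp => //.
    exact: nrm_continuous.
  exact: nrm_ge0.
have inrm : mu.-integrable setT
    (EFin \o ((fun xi => nrm xi `^ p) : borel_rV R d -> R)).
  apply/integrableP; split; first exact/measurable_EFinP.
  under eq_integral do rewrite /= ger0_norm ?powR_ge0//.
  exact: hmu.
pose c := nrm (x ord0).
have ibound : mu.-integrable setT (EFin \o
    ((fun xi => 2 `^ p * (nrm xi `^ p + c `^ p)) : borel_rV R d -> R)).
  have := integrableD measurableT inrm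
    (finite_measure_integrable_cst mu (c `^ p) measurableT).
  move=> /(integrableZl measurableT (2 `^ p)).
  exact.
apply: le_integrable ibound => //.
  apply/measurable_EFinP; apply: continuous_measurable_rV.
  exact: nearest_dist_powR_continuous.
move=> xi _ /=; rewrite lee_fin !ger0_norm ?powR_ge0//; last first.
  by rewrite mulr_ge0// ?addr_ge0// powR_ge0.
have c0 : 0 <= c by exact: nrm_ge0.
have mono a b : 0 <= a -> 0 <= b -> a <= b -> a `^ p <= b `^ p.
  by move=> *; rewrite ge0_ler_powR ?nnegrE ?(ltW p0).
(* The nearest distance is at most [nrm xi + c], hence at most twice the larger of the two. *)
apply: (@le_trans _ _ ((2 * Num.max (nrm xi) c) `^ p)).
  apply: mono; rewrite ?nearest_dist_ge0 ?mulr_ge0 ?le_max ?nrm_ge0//.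
  rewrite (le_trans (nearest_dist_le x xi ord0))// (le_trans (nrmB _ _))//.
  by rewrite mulr_natl mulr2n lerD// le_max lexx ?orbT.
rewrite powRM// ?le_max ?nrm_ge0// ler_wpM2l ?powR_ge0//.
rewrite maxEle; case: ifP => _; first by rewrite lerDr powR_ge0.
by rewrite lerDl powR_ge0.
Qed.

End nearest.
End norms.

(** * Configurations of points *)

Section surrounding.
Variables (R : realType) (d : nat) (nrm : 'rV[R]_d -> R).
Hypothesis hnrm : is_norm nrm.
Local Notation V := 'rV[R]_d.

(** Adding the origin to such a family lowers the nearest distance at 0 but changes nothing far
    away. *)
Definition surrounding k (a : 'I_k -> V) : Prop :=
  (forall i, a i != 0) /\
  exists T, forall xi, T <= nrm xi -> exists i, nrm (xi - a i) <= nrm xi.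

(** The direction [u] of [xi] is within 1 of some [a i]. Moving out from [u] to [xi] adds at most
    [nrm xi - 1], so [T = 1] works. *)
Lemma sphere_cover_surrounding k : sphere_cover nrm k ->
  exists a : 'I_k -> V, surrounding a.
Proof.
move=> [a [a1 cov]]; exists a; split => [i|].
  apply/eqP => ai0; have := a1 i; rewrite /unit_sphere /= ai0 nrm0//.
  by apply/eqP; rewrite eq_sym oner_eq0.
exists 1 => xi xi1; have xi0 : 0 < nrm xi by exact: lt_le_trans xi1.
pose u := (nrm xi)^-1 *: xi.
have u1 : nrm u = 1.
  by rewrite nrmZ// ger0_norm ?invr_ge0 ?nrm_ge0// mulVf// gt_eqF.
have [i _ ui] := cov u u1; exists i.
have -> : xi - a i = (u - a i) + (nrm xi - 1) *: u.
  rewrite scalerBl scale1r scalerA divff ?gt_eqF// scale1r.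
  by rewrite [RHS]addrC addrA subrK.
rewrite (le_trans (nrmD hnrm _ _))// nrmZ// u1 mulr1 ger0_norm ?subr_ge0//.
by rewrite -lerBrDr subKr.
Qed.

(* The vertices are a basis and minus its sum: if [|xi - a i| > |xi|] for every
   [i], then [<xi, a i> < |a i|^2 / 2] for every [i], which bounds all the
   [<xi, a i>] on both sides because the [a i] sum up to zero. *)
Lemma euclidean_surrounding : (0 < d)%N -> euclidean_norm nrm ->
  exists a : 'I_d.+1 -> V, surrounding a.
Proof.
move=> d0 [phi nrmE].
have phiC u v : phi u v = phi v u by rewrite hermC expr0 mul1r.
have phiBl u v w : phi (u - v) w = phi u w - phi v w by rewrite linearBl.
have phiBr u v w : phi u (v - w) = phi u v - phi u w.
  by rewrite phiC phiBl !(phiC u).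
have phi_ge0 u : 0 <= phi u u.
  (* The square root of a negative number is 0 by convention, so a negative [phi u u] would force
     [nrm u = 0] and then [u = 0]. *)
  rewrite leNgt; apply/negP => u_lt0.
  have : nrm u = 0 by rewrite nrmE ler0_sqrtr// ltW.
  by move=> /(nrm_eq0 hnrm) u0; move: u_lt0; rewrite u0 linear0l ltxx.
pose e (j : 'I_d) : V := delta_mx 0 j.
pose s : V := - \sum_j e j.
pose a (i : 'I_d.+1) : V := if unlift ord_max i is Some j then e j else s.
have aE j : a (lift ord_max j) = e j by rewrite /a liftK.
have aS : a ord_max = s by rewrite /a unlift_none.
have sE j : s 0 j = -1.
  rewrite /s mxE summxE (bigD1 j)//= mxE !eqxx big1 ?addr0// => k kj.
  by rewrite mxE eq_sym (negbTE kj) andbF.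
have [m m0 mnrm] := norm_le_nrm hnrm.
pose b := \sum_i phi (a i) (a i).
have b_ge i : phi (a i) (a i) <= b.
  by rewrite /b (bigD1 i)//= lerDl sumr_ge0.
have b0 : 0 <= b by exact: sumr_ge0.
exists a; split.
  move=> i; rewrite /a; case: unliftP => [j _|_]; apply/eqP => /rowP.
    by move=> /(_ j); rewrite !mxE !eqxx => /eqP; rewrite oner_eq0.
  move=> /(_ (Ordinal d0)); rewrite sE mxE => /eqP.
  by rewrite oppr_eq0 oner_eq0.
exists (b *+ d *+ d / m + 1) => xi xiT; apply: contrapT => far.
have {far} pa i : phi xi (a i) <= b.
  have : nrm xi < nrm (xi - a i).
    by rewrite ltNge; apply/negP => le; apply: far; exists i.
  rewrite !nrmE => lt_sqrt.
  have : phi xi xi < phi (xi - a i) (xi - a i).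
    rewrite ltNge; apply/negP => /ler_wsqrtr; rewrite leNgt => /negP; exact.
  rewrite phiBl !phiBr (phiC (a i)) => lt_phi.
  by have := b_ge i; move: lt_phi b0; set x := phi _ _; set y := phi _ _;
    set z := phi _ _; lra.
have pe_le j : phi xi (e j) <= b by rewrite -aE.
have pe_sum : - \sum_j phi xi (e j) <= b.
  have := pa ord_max; rewrite aS /s linearN /= linear_sum/=.
  exact.
(* For the lower bound, [- phi xi (e j)] is at most [b] plus the other [d - 1] products, each at
   most [b]. *)
have pe_norm j : `|phi xi (e j)| <= b *+ d.
  rewrite ler_norml; apply/andP; split; last first.
    rewrite (le_trans (pe_le j))// -[leLHS]mulr1n.
    by rewrite ler_wpMn2l.
  have rest : \sum_(i < d | i != j) phi xi (e i) <= b *+ d.-1.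
    apply: le_trans (ler_sum _ (fun i _ => pe_le i)) _.
    by rewrite sumr_const cardC1 card_ord.
  rewrite lerNl -[in leRHS](prednK d0) mulrS -lerBlDr.
  apply: le_trans pe_sum; rewrite (bigD1 j)//= opprD lerD2l lerN2.
  exact: rest.
have xiE : phi xi xi = \sum_j xi 0 j * phi xi (e j).
  rewrite {2}(row_sum_delta xi) linear_sum/=.
  by apply: eq_bigr => j _; rewrite phiC linearZl_LR/= phiC.
have nrm2 : nrm xi ^+ 2 <= `|xi| * (b *+ d *+ d).
  rewrite nrmE sqr_sqrtr// xiE (le_trans (ler_norm _))//.
  rewrite (le_trans (ler_norm_sum _ _ _))//.
  apply: (@le_trans _ _ (\sum_(j < d) `|xi| * (b *+ d))).
    by apply: ler_sum => j _; rewrite normrM ler_pM// rV_coord_le.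
  by rewrite sumr_const card_ord -mulrnAr.
have T0 : 0 < nrm xi.
  apply: lt_le_trans xiT; rewrite ltr_wpDl// divr_ge0 ?(ltW m0)//.
  by rewrite !mulrn_wge0.
(* The bound [nrm2] is linear in the sup norm, which is at most [nrm xi / m]; dividing by [nrm xi]
   contradicts the choice of the threshold. *)
have : nrm xi <= b *+ d *+ d / m.
  rewrite ler_pdivlMr// -(ler_pM2l T0) mulrA -expr2.
  rewrite (le_trans (ler_wpM2r (ltW m0) nrm2))//.
  rewrite mulrAC ler_wpM2r ?mulrn_wge0// mulrC.
  exact: mnrm.
by apply/negP; rewrite -ltNge (lt_le_trans _ xiT)// ltrDl.
Qed.

(** Either lower bound on [N] leaves at least one point beyond the surrounding family, to be placed
    at the origin. *)
Lemma covering_surrounding N : (0 < d)%N ->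
  ((sphere_covering_number nrm).+1 <= N)%N \/
    (euclidean_norm nrm /\ (d.+2 <= N)%N) ->
  exists k (a : 'I_k -> V), (k < N)%N /\ surrounding a.
Proof.
move=> d0 [cN|[euc dN]].
  have [cov _] := sphere_covering_numberP hnrm.
  have [a sa] := sphere_cover_surrounding cov.
  by exists (sphere_covering_number nrm), a.
have [a sa] := euclidean_surrounding d0 euc.
by exists d.+1, a.
Qed.

Lemma unbounded_nrm (T : R) : (0 < d)%N -> exists xi : V, T <= nrm xi.
Proof.
move=> d0; pose u : V := const_mx 1.
have u0 : 0 < nrm u.
  apply: (nrm_gt0 hnrm); apply/eqP => /rowP /(_ (Ordinal d0)).
  by rewrite !mxE => /eqP; rewrite oner_eq0.
exists ((`|T| / nrm u) *: u).
rewrite nrmZ// normrM normfV normr_id (gtr0_norm u0) divfK ?gt_eqF//.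
exact: ler_norm.
Qed.

(** Both configurations contain all the [a i]. The spare places are filled with the origin in [x]
    and with a repeated [a i] in [y]. *)
Lemma surrounding_configurations k (a : 'I_k -> V) n : (0 < d)%N ->
  surrounding a -> (k < n.+1)%N ->
  exists x y : 'I_n.+1 -> V,
    [/\ forall xi, nearest_dist nrm x xi <= nearest_dist nrm y xi,
        exists T, forall xi, T <= nrm xi ->
          nearest_dist nrm y xi <= nearest_dist nrm x xi,
        nearest_dist nrm x 0 = 0
      & 0 < nearest_dist nrm y 0].
Proof.
case: k a => [|k] a d0 [an0 [T aT]] kn.
  (* An empty family surrounds nothing: a vector with [nrm xi >= T] would need an index in
     ['I_0]. *)
  by have [xi /aT [[]]] := unbounded_nrm T d0.
pose x (i : 'I_n.+1) : V := if (i <= k)%N then a (inord i) else 0.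
(* Beyond [k], [inord] returns the index 0, so [y] repeats the first point. *)
pose y (i : 'I_n.+1) : V := a (inord i).
have xa j : x (inord (j : 'I_k.+1)) = a j.
  by rewrite /x inordK ?(ltn_trans (ltn_ord j))// -ltnS ltn_ord inord_val.
have ya j : y (inord (j : 'I_k.+1)) = a j.
  by rewrite /y inordK ?(ltn_trans (ltn_ord j))// inord_val.
have x0 : x ord_max = 0 by rewrite /x /= leqNgt -ltnS kn.
exists x, y; split.
- move=> xi; have [i ->] := nearest_dist_attained nrm y xi.
  by rewrite /y -xa; exact: nearest_dist_le.
- exists T => xi /aT [j aj]; have [i ->] := nearest_dist_attained nrm x xi.
  rewrite /x; case: ifP => _; first by rewrite -ya; exact: nearest_dist_le.
  by rewrite subr0; apply: le_trans aj; rewrite -ya; exact: nearest_dist_le.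
- apply/eqP; rewrite eq_le (nearest_dist_ge0 hnrm) andbT.
  by rewrite (le_trans (nearest_dist_le _ _ _ ord_max))// x0 subrr nrm0.
- have [i ->] := nearest_dist_attained nrm y 0.
  by rewrite sub0r (nrmN hnrm) nrm_gt0// an0.
Qed.

End surrounding.

(** * The bump given by two configurations and the equality of the measures *)

Theorem theorem2p1 (R : realType) (d : nat) (hd : (1 <= d)%N) (p : R)
    (hp : 1 <= p) (nrm : 'rV[R]_d -> R) (hnrm : is_norm nrm) (N : nat)
    (hN : ((sphere_covering_number nrm).+1 <= N)%N \/
          (euclidean_norm nrm /\ (d.+2 <= N)%N))
    (mu nu : probability (borel_rV R d) R)
    (hmu : finite_moment nrm p mu) (hnu : finite_moment nrm p nu) (C : R)
    (hC : forall x : 'I_N -> 'rV[R]_d,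
       (quantization_error nrm p mu x `^ p =
        quantization_error nrm p nu x `^ p + C%:E)%E) :
  (forall A : set (borel_rV R d), measurable A -> mu A = nu A) /\ C = 0.
Proof.
have p0 : 0 < p by exact: lt_le_trans hp.
have [k [a [kN sa]]] := covering_surrounding hnrm hd hN.
case: N hN hC kN => // n _ hC kn.
have [x [y [xy [T yx] x0 y0]]] := surrounding_configurations hnrm hd sa kn.
pose err (z : 'I_n.+1 -> 'rV[R]_d) xi := nearest_dist nrm z xi `^ p.
have ierr (m : probability (borel_rV R d) R) (hm : finite_moment nrm p m) z :
    m.-integrable setT (EFin \o (err z : borel_rV R d -> R)).
  exact: nearest_dist_powR_integrable.
(* Finite moments make both integrals finite, so the hypothesis becomes an identity of real numbers,
   where subtraction is safe. *)
have Eerr z : \int[mu]_xi (err z xi : R) = \int[nu]_xi (err z xi : R) + C.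
  have fin (m : probability (borel_rV R d) R) (hm : finite_moment nrm p m) :
      (\int[m]_xi (err z xi)%:E = (\int[m]_xi (err z xi : R))%:E)%E.
    rewrite /Rintegral fineK//; apply: integrable_fin_num => //.
    exact: ierr.
  have := hC z; rewrite !quantization_errorE//.
  by rewrite -/(err z) [in LHS]fin// [in RHS]fin// -EFinD => -[].
pose phi xi := err y xi - err x xi.
have nd_ge0 z xi : 0 <= nearest_dist nrm z xi by exact: nearest_dist_ge0.
have mono (u v : R) : 0 <= u -> 0 <= v -> u <= v -> u `^ p <= v `^ p.
  by move=> *; rewrite ge0_ler_powR ?nnegrE ?(ltW p0).
have phi_ge0 xi : 0 <= phi xi by rewrite subr_ge0 mono.
have cphi : continuous phi.
  move=> xi; apply: (@continuousB _ _ _ (err y) (err x)).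
    exact: nearest_dist_powR_continuous.
  exact: nearest_dist_powR_continuous.
have [m m0 mnrm] := norm_le_nrm hnrm.
(* Dividing by [m] turns the threshold for [nrm] into one for the sup norm. *)
have phiT xi : T / m <= `|xi| -> phi xi = 0.
  rewrite ler_pdivrMr// mulrC => xiT; apply/eqP; rewrite subr_eq0.
  rewrite /err (_ : nearest_dist nrm y xi = nearest_dist nrm x xi)//.
  by apply/eqP; rewrite eq_le xy yx// (le_trans xiT).
have phics : compactly_supported phi.
  by split => //; exists (T / m) => xi xiT; rewrite phiT// ltW.
have [B phiB] := compactly_supported_bounded phics.
pose c := phi 0 / 2.
have phi0 : 0 < phi 0.
  by rewrite subr_gt0 /err x0 powR0 ?gt_eqF// powR_gt0.
have c0 : 0 < c by rewrite divr_gt0.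
have [r r0 phic] : exists2 r : R, 0 < r & forall xi, `|xi| <= r -> c <= phi xi.
  have [r r0 hr] := compactly_supported_unif_continuous c0 phics.
  exists (r / 2); first by rewrite divr_gt0.
  move=> xi xir; have : `|phi 0 - phi xi| < c.
    by apply: hr; rewrite sub0r normrN (le_lt_trans xir)// ltr_pdivrMr//
      ltr_pMr// ltr1n.
  by move=> /(le_lt_trans (ler_norm _)); rewrite /c; lra.
(* A rescaled translate of [phi] is, up to the factor [t ^ (- p)], the difference of the errors of
   the moved configurations [q y] and [q x]; the two copies of [C] cancel. *)
have Ephi (t : R) (z : 'rV[R]_d) : 0 < t ->
    \int[mu]_xi phi (t^-1 *: (xi - z)) = \int[nu]_xi phi (t^-1 *: (xi - z)).
  move=> t0; pose q (w : 'I_n.+1 -> 'rV[R]_d) i := t *: w i + z.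
  have errE w xi : err w (t^-1 *: (xi - z)) = (t `^ p)^-1 * err (q w) xi.
    rewrite /err nearest_dist_affine// powRM ?(ltW t0)//.
    by rewrite mulKf// gt_eqF// powR_gt0.
  have E (m' : probability (borel_rV R d) R) (hm : finite_moment nrm p m') :
      \int[m']_xi phi (t^-1 *: (xi - z)) = (t `^ p)^-1 *
        (\int[m']_xi (err (q y) xi : R) - \int[m']_xi (err (q x) xi : R)).
    rewrite -RintegralB//; [|exact: ierr|exact: ierr].
    rewrite -RintegralZl//; last first.
      rewrite (_ : _ \o _ = (EFin \o err (q y)) \- (EFin \o err (q x)))%E//.
      by apply: integrableB => //; exact: ierr.
    by apply: eq_Rintegral => xi _; rewrite /phi !errE mulrBr.
  have cancel (u v u' v' : R) : u = u' + C -> v = v' + C -> u - v = u' - v'.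
    by move=> -> ->; rewrite opprD addrACA subrr addr0.
  apply: (etrans (E mu hmu)); apply: (etrans _ (esym (E nu hnu))).
  by congr (_ * _); exact: cancel (Eerr (q y)) (Eerr (q x)).
have Emunu A : measurable A -> mu A = nu A.
  apply: probability_eq_compactly_supported => //.
  apply: (compactly_supported_Rintegral_eq cphi c0 r0 _ phiT phic Ephi).
  by move=> xi; rewrite phi_ge0 (le_trans (ler_norm _))// phiB.
(* Once the measures agree, the identity for any single configuration, here [x], yields [C = 0]. *)
split=> //; have := Eerr x.
rewrite /Rintegral (@eq_measure_integral _ _ _ _ nu mu)//; last first.
  by move=> A mA _; exact: Emunu.
by move=> /eqP; rewrite addrC -subr_eq subrr eq_sym => /eqP.
Qed.
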